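(* Let $X$ and $Y$ be complete, separable, locally compact metric spaces, and equip $X$, $Y$ and $X\times Y$ with their Borel $\sigma$-algebras $\mathfrak{B}_X$, $\mathfrak{B}_Y$ and $\mathfrak{B}_{X\times Y}$. Let $\zeta$ be a probability measure on $\mathfrak{B}_{X\times Y}$, with marginal probabilities $\mu$ on $\mathfrak{B}_X$ and $\nu$ on $\mathfrak{B}_Y$, i.e. $\mu(A)=\zeta(A\times Y)$ for all $A\in\mathfrak{B}_X$ and $\nu(B)=\zeta(X\times B)$ for all $B\in\mathfrak{B}_Y$. Then there exist a set $E_1\in\mathfrak{B}_X$ with $\mu(E_1)=0$ and, for every $x\in X\setminus E_1$, a measure $\nu_x$ on $\mathfrak{B}_Y$, and there exist a set $E_2\in\mathfrak{B}_Y$ with $\nu(E_2)=0$ and, for every $y\in Y\setminus E_2$, a measure $\mu_y$ on $\mathfrak{B}_X$, such that all of the following hold. (A) For every $C\in\mathfrak{B}_{X\times Y}$, the function $x\in X\setminus E_1\mapsto \nu_x(C_x)$ is $\mathfrak{B}_X$-measurable and $$\zeta(C)=\int_X \nu_x(C_x)\,\mu(dx).$$ In particular, $\nu(B)=\int_X\nu_x(B)\,\mu(dx)$ for all $B\in\mathfrak{B}_Y$. Moreover, for every positive (i.e. nonnegative) $\mathfrak{B}_{X\times Y}$-measurable function $f:X\times Y\to\mathbb{R}$, the function $x\in X\setminus E_1\mapsto\int_Y f(x,y)\,\nu_x(dy)$ is $\mathfrak{B}_X$-measurable and $$\int_{X\times Y} f(x,y)\,\zeta(dx,dy)=\int_X\left(\int_Y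 f(x,y)\,\nu_x(dy)\right)\mu(dx).$$ (B) For every $C\in\mathfrak{B}_{X\times Y}$, the function $y\in Y\setminus E_2\mapsto \mu_y(C_y)$ is $\mathfrak{B}_Y$-measurable and $$\zeta(C)=\int_Y \mu_y(C_y)\,\nu(dy).$$ In particular, $\mu(A)=\int_Y\mu_y(A)\,\nu(dy)$ for all $A\in\mathfrak{B}_X$. Moreover, for every positive (i.e. nonnegative) $\mathfrak{B}_{X\times Y}$-measurable function $f:X\times Y\to\mathbb{R}$, the function $y\in Y\setminus E_2\mapsto\int_X f(x,y)\,\mu_y(dx)$ is $\mathfrak{B}_Y$-measurable and $$\int_{X\times Y} f(x,y)\,\zeta(dx,dy)=\int_Y\left(\int_X f(x,y)\,\mu_y(dx)\right)\nu(dy).$$ (C) For every $\mathfrak{B}_{X\times Y}$-measurable function $f:X\times Y\to\mathbb{R}$, the following are equivalent: (1) $f$ is $\zeta$-integrable; (2) $x\in X\setminus E_1\mapsto\int_Y|f(x,y)|\,\nu_x(dy)$ is $\mu$-integrable; (3) $y\in Y\setminus E_2\mapsto\int_X|f(x,y)|\,\mu_y(dx)$ is $\nu$-integrable; and, when these hold, $$\int_{X\times Y} f(x,y)\,\zeta(dx,dy)=\int_X\left(\int_Y f(x,y)\,\nu_x(dy)\right)\mu(dx)=\int_Y\left(\int_X f(x,y)\,\mu_y(dx)\right)\nu(dy).$$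
   Context: For $C\subseteq X\times Y$, the slices are $C_x=\{y\in Y:(x,y)\in C\}\subseteq Y$ for $x\in X$ and $C_y=\{x\in X:(x,y)\in C\}\subseteq X$ for $y\in Y$. Functions defined only on $X\setminus E_1$ (resp. $Y\setminus E_2$) are integrated against $\mu$ (resp. $\nu$) over $X$ (resp. $Y$) by ignoring the null set $E_1$ (resp. $E_2$). Integrals of nonnegative functions may take the value $+\infty$. In (C), the inner integrals of $f$ are understood to be defined almost everywhere with respect to the outer measure. *)

(* Defs.v *)
From HB Require Import structures.
From mathcomp Require Import all_boot all_order all_algebra.
From mathcomp Require Import all_classical all_reals all_analysis.
From mathcomp Require Import measurable_realfun.

Set Implicit Arguments.
Unset Strict Implicit.
Unset Printing Implicit Defensive.

Import Order.TTheory GRing.Theory Num.Theory.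
Import numFieldNormedType.Exports.

Local Open Scope classical_set_scope.

(* The library's completeType is pointed, hence nonempty; this is no loss for a
   space that carries a probability measure. *)
#[short(type="completeMetricType")]
HB.structure Definition CompleteMetric (R : numDomainType) :=
  { T of Metric R T & Complete T }.

Definition separable_space (T : topologicalType) :=
  exists2 D : set T, countable D & dense D.

(* On a product, borel (X * Y) is generated by the open sets of the product
   topology; it is not the library's canonical product sigma-algebra on
   borel X * borel Y. *)
Notation borel T := (g_sigma_algebraType (@open T%type)).

(* Main.v *)
(* The marginal mu is disintegrated through the real line. For a probability on
   X * R, let g_r be the Radon-Nikodym density with respect to mu of
   A |-> zeta (A * ]-oo, r]); then x |-> inf_(q > r, q rational) min(g_q x, 1)
   is for every x a bounded right-continuous nondecreasing function of r, hence
   defines a Stieltjes measure, and almost everywhere it agrees with g_r. The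
   resulting kernel disintegrates zeta because both sides agree on the
   rectangles A * ]a, b].
   A separable complete metric space Y is a measurable retract of R: the bits
   "y lies in the n-th ball of a countable base" are packed into a real number,
   and y is recovered as the limit of centres of shrinking balls containing it.
   So a disintegration over X * R pushes forward to one over X * Y. Separability
   of Y makes the Borel sets of X * Y the product sigma-algebra. The kernels
   are defined everywhere, so that E1 and E2 can be taken empty. *)
Require Import Defs.
From HB Require Import structures.
From mathcomp Require Import all_boot all_order all_algebra.
From mathcomp Require Import all_classical all_reals all_analysis.
From mathcomp Require Import measurable_realfun.
From mathcomp Require Import lra.

Set Implicit Arguments.
Unset Strict Implicit.
Unset Printing Implicit Defensive.

Import Order.TTheory GRing.Theory Num.Theory.
Import numFieldNormedType.Exports.

Local Open Scope classical_set_scope.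
Local Open Scope ring_scope.
Local Open Scope ereal_scope.

(** * Image measures, and the product of a probability with a kernel *)

Definition image_measure d d' (T1 : measurableType d) (T2 : measurableType d')
  (R : realType) (m : {measure set T1 -> \bar R}) (f : T1 -> T2)
  (mf : measurable_fun setT f) : {measure set T2 -> \bar R} :=
  ltac:(refine (pushforward m f : {measure set T2 -> \bar R}); exact: mf).

Section kernel_on_graph.
Context d d' (X : measurableType d) (Y : measurableType d') (R : realType).
Variable k : R.-fker X ~> Y.

(* The unit component is the constant parameter over which [mkcomp] integrates
   in [semidirect] below. *)
Definition graph_kernel (z : unit * X) : {measure set (X * Y) -> \bar R} :=
  image_measure (k z.2) (pair1_measurable z.2).

Lemma graph_kernelE z C :
  graph_kernel z C = k z.2 (xsection C z.2).
Proof. by rewrite xsectionE. Qed.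

Let measurable_graph_kernel C : measurable C ->
  measurable_fun [set: unit * X] (graph_kernel ^~ C).
Proof.
move=> mC; under eq_fun do rewrite graph_kernelE.
apply: (@measurableT_comp _ _ _ _ _ _ (fun x => k x (xsection C x))) => //.
by apply: measurable_fun_xsection_finite_kernel; rewrite inE.
Qed.

HB.instance Definition _ := isKernel.Build _ _ _ _ R graph_kernel
  measurable_graph_kernel.

Let graph_kernel_uub : measure_fam_uub graph_kernel.
Proof.
have [r hr] := measure_uub k; exists r => z.
by rewrite graph_kernelE xsectionE preimage_setT.
Qed.

HB.instance Definition _ := Kernel_isFinite.Build _ _ _ _ R graph_kernel
  graph_kernel_uub.

End kernel_on_graph.

Section semidirect_product.
Context d d' (X : measurableType d) (Y : measurableType d') (R : realType).
Variables (mu : probability X R) (k : R.-fker X ~> Y).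

Let l : R.-sfker unit ~> X :=
  kprobability (@measurable_cst _ _ unit (pprobability X R) setT mu).

(** The measure [mu(dx) k x (dy)], built as a composition of kernels started at [unit], so that the
    measure axioms and the iterated integral formula come from kernel composition. *)
Definition semidirect : {measure set (X * Y) -> \bar R} :=
  mkcomp l (graph_kernel k) tt.

Lemma semidirectE C : semidirect C = \int[mu]_x k x (xsection C x).
Proof. by apply: eq_integral => x _; rewrite graph_kernelE. Qed.

Lemma ge0_integral_semidirect (f : X * Y -> \bar R) :
  measurable_fun setT f -> (forall z, 0 <= f z) ->
  \int[semidirect]_z f z = \int[mu]_x \int[k x]_y f (x, y).
Proof.
move=> mf f0; rewrite [LHS](integral_kcomp l (graph_kernel k))//.
apply: eq_integral => x _.
by rewrite /= ge0_integral_pushforward.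
Qed.

Lemma semidirect_setX A B : measurable A ->
  semidirect (A `*` B) = \int[mu]_(x in A) k x B.
Proof.
move=> mA; rewrite semidirectE [RHS]integral_mkcond.
apply: eq_integral => x _; rewrite patchE.
case: ifPn => xA; first by rewrite in_xsectionX.
by rewrite notin_xsectionX ?measure0.
Qed.

End semidirect_product.

(** * Measurability from a generator, almost everywhere comparison, densities *)

Lemma measurable_measure_generator d d' (X : measurableType d)
    (Y : measurableType d') (R : realType) (G : set (set Y))
    (k : X -> {measure set Y -> \bar R}) :
  @measurable _ Y = <<s G >> -> setI_closed G ->
  (forall x, k x setT < +oo) ->
  measurable_fun setT (k ^~ setT) ->
  (forall B, G B -> measurable_fun setT (k ^~ B)) ->
  forall B, measurable B -> measurable_fun setT (k ^~ B).
Proof.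
move=> mG GI kfin kT kG B mB.
(* [P] is a Dynkin system: complements are handled by subtracting from the finite total mass,
   disjoint unions by countable sums. *)
pose P : set_system Y := [set B | measurable_fun setT (k ^~ B)].
suff: P B by [].
apply: (@dynkin_induction _ _ G) => //; last by rewrite -mG.
- move=> S mS PS; rewrite /P /=.
  rewrite (_ : k ^~ _ = (fun x => k x setT - k x S)); last first.
    by apply/funext => x; rewrite -setTD measureD// ?setTI//; exact: kfin.
  exact: emeasurable_funB.
- move=> F mF tF PF; rewrite /P /=.
  rewrite (_ : k ^~ _ =
      (fun x => \sum_(n <oo | n \in predT) k x (F n))); last first.
    apply/funext => x; rewrite measure_bigcup//.
    by apply: eq_eseriesl => n; rewrite in_setT.
  apply: ge0_emeasurable_sum => //.
  by move=> n _; exact: PF.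
Qed.

(** On the set where [g < f], the integral of [|f - g|] is that of [f - g], which the hypothesis
    makes nonpositive. Hence [f = g] almost everywhere on this set, so it is null. *)
Lemma ae_le_of_integral d (X : measurableType d) (R : realType)
    (mu : {measure set X -> \bar R}) (f g : X -> R) :
  mu.-integrable setT (EFin \o f) -> mu.-integrable setT (EFin \o g) ->
  (forall A, measurable A ->
    \int[mu]_(x in A) (f x)%:E <= \int[mu]_(x in A) (g x)%:E) ->
  {ae mu, forall x, (f x <= g x)%R}.
Proof.
move=> intf intg fg.
have mf : measurable_fun setT f by exact/measurable_EFinP/measurable_int/intf.
have mg : measurable_fun setT g by exact/measurable_EFinP/measurable_int/intg.
pose D := [set x | (g x < f x)%R].
have mD : measurable D.
  by rewrite -[D]setTI; apply: measurable_fun_ltr.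
have [intfD intgD] : mu.-integrable D (EFin \o f) /\
    mu.-integrable D (EFin \o g).
  by split; apply: (integrableS measurableT).
have : \int[mu]_(x in D) `|(f x)%:E - (g x)%:E| = 0.
  apply/eqP; rewrite eq_le integral_ge0// andbT.
  rewrite (eq_integral ((EFin \o f) \- (EFin \o g))); last first.
    by move=> x /[!inE] Dx; rewrite gee0_abs// sube_ge0// lee_fin ltW.
  rewrite integralB//= leeBlDr ?add0e; first exact: fg.
  exact: integrable_fin_num.
move/ae_eq_integral_abs => /(_ mD); case.
  exact: measurable_int (integrableB mD intfD intgD).
move=> N [mN N0 sN]; exists N; split => //; apply: (subset_trans _ sN) => x /=.
move/negP; rewrite -ltNge => gf; apply/not_implyP; split => // -[] /eqP.
by rewrite subr_eq0 gt_eqF.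
Qed.

Lemma radon_nikodym_density d (X : measurableType d) (R : realType)
    (mu : {sigma_finite_measure set X -> \bar R})
    (nu : {measure set X -> \bar R}) :
  nu setT < +oo -> (forall A, measurable A -> nu A <= mu A) ->
  exists g : X -> R, [/\ forall x, (0 <= g x)%R, measurable_fun setT g &
    forall A, measurable A -> nu A = \int[mu]_(x in A) (g x)%:E].
Proof.
move=> nufin numu.
(* Restricting [nu] to the whole space leaves its values unchanged and attaches finiteness to the
   measure. *)
pose nu' := mfrestr measurableT nufin.
have nu'E A : nu' A = nu A by rewrite /nu' /mfrestr /mrestr setIT.
have dom : nu' `<< mu.
  apply/null_content_dominatesP => A mA muA0; apply/eqP.
  by rewrite eq_le measure_ge0 andbT -muA0 nu'E; exact: numu.
have [f [f0 ffin intf fE]] := radon_nikodym_sigma_finite dom.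
exists (fine \o f); split => [x||].
- by rewrite fine_ge0.
- apply/measurable_EFinP.
  rewrite (_ : EFin \o (fine \o f) = f); first exact: measurable_int intf.
  by apply/funext => x /=; rewrite fineK.
- move=> A mA; rewrite -nu'E [LHS]fE//.
  by apply: eq_integral => x _ /=; rewrite fineK.
Qed.

(** * Conditional distribution functions and their Stieltjes kernel *)

Section conditional_cdf.
Context d (X : measurableType d) (R : realType).
Variable g : R -> X -> R.
Hypothesis g_ge0 : forall r x, (0 <= g r x)%R.
Hypothesis mg : forall r, measurable_fun setT (g r).

(** Numbers that encode no rational are sent to 0, which only repeats a value. *)
Definition rat_enum (n : nat) : R := ratr (odflt 0%Q (unpickle n)).

Lemma rat_enum_itv (a b : R) : (a < b)%R ->
  exists n, (a < rat_enum n < b)%R.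
Proof.
move=> /rat_in_itvoo[q]; rewrite in_itv/= => aqb.
by exists (pickle q); rewrite /rat_enum pickleK.
Qed.

(* An infimum over rationals above [r] of functions of the form min(g_q, 1) is
   nondecreasing and right-continuous in [r] at every point [x], even though
   [q |-> g_q x] is monotone only for almost every [x]: no exceptional null set
   has to be removed. *)
Definition cdf_term x r n : R :=
  if (r < rat_enum n)%R then Num.min (g (rat_enum n) x) 1%R else 1%R.

Definition conditional_cdf x r : R := inf (range (cdf_term x r)).

Lemma cdf_term_ge0 x r n : (0 <= cdf_term x r n)%R.
Proof. by rewrite /cdf_term; case: ifP => // _; rewrite le_min g_ge0 ler01. Qed.

Lemma cdf_term_le1 x r n : (cdf_term x r n <= 1)%R.
Proof. by rewrite /cdf_term; case: ifP => // _; rewrite ge_min lexx orbT. Qed.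

Lemma cdf_term_nondecreasing x n : {homo (cdf_term x)^~ n : r s / (r <= s)%R}.
Proof.
move=> r s rs; rewrite {2}/cdf_term; case: ifPn => [sn|_].
  by rewrite /cdf_term (le_lt_trans rs sn).
exact: cdf_term_le1.
Qed.

Lemma has_lbound_cdf_term x r : has_lbound (range (cdf_term x r)).
Proof. by exists 0%R => _ [n _ <-]; exact: cdf_term_ge0. Qed.

Lemma conditional_cdf_le_term x r n : (conditional_cdf x r <= cdf_term x r n)%R.
Proof. by apply: ge_inf; [exact: has_lbound_cdf_term|exists n]. Qed.

Lemma le_conditional_cdf x r y :
  (forall n, (y <= cdf_term x r n)%R) -> (y <= conditional_cdf x r)%R.
Proof.
by move=> h; apply: lb_le_inf => [|_ [n _ <-]//]; exists (cdf_term x r 0), 0%N.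
Qed.

Lemma conditional_cdf_ge0 x r : (0 <= conditional_cdf x r)%R.
Proof. by apply: le_conditional_cdf => n; exact: cdf_term_ge0. Qed.

Lemma conditional_cdf_le1 x r : (conditional_cdf x r <= 1)%R.
Proof.
exact: le_trans (conditional_cdf_le_term x r 0) (cdf_term_le1 _ _ _).
Qed.

Lemma conditional_cdf_nondecreasing x : nondecreasing (conditional_cdf x).
Proof.
move=> r s rs; apply: le_conditional_cdf => n.
exact: le_trans (conditional_cdf_le_term _ _ n) (cdf_term_nondecreasing _ _ rs).
Qed.

(** Take a term that nearly attains the infimum at [r]. Either its rational is above [r], and the
    term keeps its value just to the right of [r], or the term is 1, which bounds
    [conditional_cdf x] everywhere. *)
Lemma conditional_cdf_right_continuous x : right_continuous (conditional_cdf x).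
Proof.
move=> r; apply/cvgrPdist_lt => e e0.
have [_ [n _ <-] ne] : exists2 y, range (cdf_term x r) y &
    (y < conditional_cdf x r + e)%R.
  apply: inf_adherent => //; split; last exact: has_lbound_cdf_term.
  by exists (cdf_term x r 0), 0%N.
have close s : (r <= s)%R ->
    (conditional_cdf x s < conditional_cdf x r + e)%R ->
    (`|conditional_cdf x r - conditional_cdf x s| < e)%R.
  move=> rs se; rewrite distrC ger0_norm ?ltrBlDl//.
  by rewrite subr_ge0 conditional_cdf_nondecreasing.
have [rn|nr] := ltP r (rat_enum n); last first.
  near=> s; apply: close => //; apply: le_lt_trans ne.
  by rewrite [leRHS]/cdf_term ltNge nr/= conditional_cdf_le1.
near=> s; apply: close => //.
apply: le_lt_trans ne; apply: le_trans (conditional_cdf_le_term _ _ n) _.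
rewrite /cdf_term rn ifT//; near: s; exact: nbhs_right_lt.
Unshelve. all: by end_near. Qed.

HB.instance Definition _ x := isCumulative.Build R _ R (conditional_cdf x)
  (@conditional_cdf_nondecreasing x) (@conditional_cdf_right_continuous x).

Lemma measurable_conditional_cdf r :
  measurable_fun setT (fun x => conditional_cdf x r).
Proof.
rewrite (_ : (fun _ => _) = (fun x => infs (cdf_term x r) 0%N)); last first.
  apply/funext => x; rewrite /infs/= /conditional_cdf; congr inf.
  by apply/seteqP; split => y [n ? ?]; exists n.
apply: (@measurable_fun_infs _ _ _ _ (fun n x => cdf_term x r n)).
  by move=> x _; exact: has_lbound_cdf_term.
move=> n; 
rewrite /cdf_term; case: (r < _)%R => //.
exact: measurable_minr.
Qed.

Definition stieltjes_kernel (x : X) :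
    {measure set (measurableTypeR R) -> \bar R} :=
  lebesgue_stieltjes_measure (conditional_cdf x).

Lemma stieltjes_kernel_itv x a b : (a <= b)%R ->
  stieltjes_kernel x `]a, b]%classic =
    (conditional_cdf x b)%:E - (conditional_cdf x a)%:E.
Proof.
move=> ab; rewrite /stieltjes_kernel /= /lebesgue_stieltjes_measure.
rewrite /measure_extension/= measurable_mu_extE/=; last exact: is_ocitv.
by rewrite wlength_itv_bnd.
Qed.

(** The whole line is not a bounded half-open interval, so the bound on the total mass and its
    measurability in [x] are both obtained along this exhaustion. *)
Lemma stieltjes_kernel_cvgT x :
  stieltjes_kernel x `](- n%:R)%R, (n%:R)%R]%classic @[n --> \oo] -->
  stieltjes_kernel x setT.
Proof.
rewrite -(bigcup_itvT false false).
apply: (@nondecreasing_cvg_mu _ _ _ (stieltjes_kernel x)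
   (fun n => `](- n%:R)%R, (n%:R)%R]%classic)) => //.
  exact: bigcup_measurable.
by move=> *; apply/subsetPset/subset_itv; rewrite leBSide/= ?lerN2 ler_nat.
Qed.

Let stieltjes_kernel_itv_le1 x a b : (a <= b)%R ->
  stieltjes_kernel x `]a, b]%classic <= 1.
Proof.
move=> ab; rewrite stieltjes_kernel_itv// -EFinB lee_fin lerBlDr.
by rewrite (le_trans (conditional_cdf_le1 x b))// lerDl conditional_cdf_ge0.
Qed.

(** Nothing forces [conditional_cdf x] to run from 0 to 1 at every [x], so the kernel is a
    sub-probability one. *)
Lemma stieltjes_kernelT_le1 x : stieltjes_kernel x setT <= 1.
Proof.
apply: (cvge_to_le (@stieltjes_kernel_cvgT x)).
apply: nearW => n; apply: stieltjes_kernel_itv_le1.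
by rewrite -subr_ge0 opprK addr_ge0.
Qed.

Let measurable_stieltjes_kernel_itv a b :
  measurable_fun setT (fun x => stieltjes_kernel x `]a, b]%classic).
Proof.
have [ab|ba] := leP a b; last first.
  rewrite set_itv_ge; last by rewrite bnd_simp -leNgt ltW.
  by under eq_fun do rewrite measure0; exact: measurable_cst.
under eq_fun do rewrite stieltjes_kernel_itv//.
by apply/measurable_EFinP/measurable_funB; exact: measurable_conditional_cdf.
Qed.

Let measurable_stieltjes_kernel U : measurable U ->
  measurable_fun setT (stieltjes_kernel ^~ U).
Proof.
move=> mU; have := @measurable_measure_generator _ _ X (measurableTypeR R) R
  (@ocitv R) stieltjes_kernel _ _ _ _ _ U mU; apply => //.
- exact: ocitvI.
- by move=> x; apply: le_lt_trans (stieltjes_kernelT_le1 x) _; rewrite ltry.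
- apply: (emeasurable_fun_cvg
    (fun n x => stieltjes_kernel x `](- n%:R)%R, (n%:R)%R]%classic)) => //.
  by move=> x _; exact: stieltjes_kernel_cvgT.
- move=> _ [[a b] _ <-]; exact: measurable_stieltjes_kernel_itv.
Qed.

HB.instance Definition _ := isKernel.Build _ _ _ _ R stieltjes_kernel
  measurable_stieltjes_kernel.

Let stieltjes_kernel_sprob :
  ereal_sup [set stieltjes_kernel x setT | x in [set: X]] <= 1.
Proof.
by apply: ge_ereal_sup => _ [x _ <-]; exact: stieltjes_kernelT_le1.
Qed.

HB.instance Definition _ := Kernel_isSubProbability.Build _ _ _ _ R
  stieltjes_kernel stieltjes_kernel_sprob.

Lemma exists_stieltjes_kernel :
  exists k : R.-spker X ~> measurableTypeR R, forall x a b, (a <= b)%R ->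
    k x `]a, b]%classic = (conditional_cdf x b)%:E - (conditional_cdf x a)%:E.
Proof. by exists stieltjes_kernel; exact: stieltjes_kernel_itv. Qed.

End conditional_cdf.

(** * Disintegration over a product with the real line *)

Section product_slices.
Context d d' (X : measurableType d) (Y : measurableType d') (R : realType).
Variable m : {measure set (X * Y) -> \bar R}.

(** Slices reduce rectangles to measures on one factor: Radon-Nikodym is applied to [fst_slice],
    monotone limits and uniqueness to [snd_slice]. *)
Definition fst_slice (B : set Y) (mB : measurable B) :
    {measure set X -> \bar R} :=
  image_measure (mrestr m (measurableX measurableT mB)) measurable_fst.

Lemma fst_sliceE B (mB : measurable B) A : fst_slice mB A = m (A `*` B).
Proof. by congr (m _); apply/seteqP; split=> -[x y] /=; tauto. Qed.

Definition snd_slice (A : set X) (mA : measurable A) :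
    {measure set Y -> \bar R} :=
  image_measure (mrestr m (measurableX mA measurableT)) measurable_snd.

Lemma snd_sliceE A (mA : measurable A) B : snd_slice mA B = m (A `*` B).
Proof. by congr (m _); apply/seteqP; split=> -[x y] /=; tauto. Qed.

End product_slices.

Lemma product_measure_unique d d' (X : measurableType d) (Y : measurableType d')
    (R : realType) (m1 m2 : {measure set (X * Y) -> \bar R}) :
  m1 setT < +oo ->
  (forall A B, measurable A -> measurable B -> m1 (A `*` B) = m2 (A `*` B)) ->
  forall C, measurable C -> m1 C = m2 C.
Proof.
move=> m1fin m12 C mC.
(* The total mass being finite, the constant sequence [setT] can serve as the exhaustion. *)
apply: (measure_unique [set A `*` B | A in measurable & B in measurable]
  (fun=> setT)) => //.
- exact: measurable_prod_measurableType.
- move=> _ _ [A mA [B mB <-]] [A' mA' [B' mB' <-]]; rewrite -setXI.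
  exists (A `&` A'); first exact: measurableI.
  by exists (B `&` B') => //; exact: measurableI.
- by move=> _; exists setT => //; exists setT => //; rewrite setXTT.
- by rewrite bigcup_const//; exists 0%N.
- by move=> _ [A mA [B mB <-]]; exact: m12.
Qed.

Section disintegration_real.
Context d (X : measurableType d) (R : realType).
Variables (zeta : {measure set (X * measurableTypeR R) -> \bar R}).
Variable mu : probability X R.
Hypothesis mu_fst : forall A, measurable A -> mu A = zeta (A `*` setT).

Let zeta_fin C : measurable C -> zeta C < +oo.
Proof.
move=> mC; apply: (@le_lt_trans _ _ (zeta setT)).
  by rewrite le_measure ?inE.
by rewrite -setXTT -mu_fst// [ltLHS]probability_setT ltry.
Qed.

Let mray (r : R) : measurable (`]-oo, r]%classic : set (measurableTypeR R)).
Proof. exact: measurable_itv. Qed.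

Let density r : exists g : X -> R, [/\ forall x, (0 <= g x)%R,
  measurable_fun setT g & forall A, measurable A ->
    zeta (A `*` `]-oo, r]%classic) = \int[mu]_(x in A) (g x)%:E].
Proof.
have [||g [g0 mg gE]] :=
  @radon_nikodym_density _ _ _ mu (fst_slice zeta (mray r)).
- by rewrite fst_sliceE zeta_fin//; exact: measurableX.
- move=> A mA; rewrite fst_sliceE [leRHS](mu_fst mA) le_measure ?inE//;
    [exact: measurableX..|exact: setSX].
by exists g; split=> // A mA; rewrite -gE// fst_sliceE.
Qed.

Let g r := sval (cid (density r)).

Let g0 r x : (0 <= g r x)%R.
Proof. by rewrite /g; case: cid => /= ? []. Qed.

Let mg r : measurable_fun setT (g r).
Proof. by rewrite /g; case: cid => /= ? []. Qed.

Let gE r A : measurable A ->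
  zeta (A `*` `]-oo, r]%classic) = \int[mu]_(x in A) (g r x)%:E.
Proof. by rewrite /g; case: cid => /= ? [_ _]; exact. Qed.

Let intg r : mu.-integrable setT (EFin \o g r).
Proof.
apply/integrableP; split; first exact/measurable_EFinP.
under eq_integral do rewrite gee0_abs ?lee_fin//.
by rewrite -gE// zeta_fin//; exact: measurableX.
Qed.

Let g_nondecreasing r s : (r <= s)%R -> {ae mu, forall x, (g r x <= g s x)%R}.
Proof.
move=> rs; apply: ae_le_of_integral => // A mA; rewrite -!gE//.
by apply: le_measure; rewrite ?inE; [exact: measurableX..|apply: setSX];
  rewrite // => y; rewrite /= !in_itv/= => /le_trans; exact.
Qed.

(** The truncation at 1 in [cdf_term] thus changes each density only on a null set. *)
Let g_le1 r : {ae mu, forall x, (g r x <= 1)%R}.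
Proof.
apply: (@ae_le_of_integral _ _ _ _ _ (cst 1%R)) => //.
  exact: finite_measure_integrable_cst.
move=> A mA; rewrite -gE// [leRHS](integral_cst _ mA 1) mul1e [leRHS](mu_fst mA).
by rewrite le_measure ?inE//; [exact: measurableX..|exact: setSX].
Qed.

Let F := conditional_cdf g.

Let mF r : measurable_fun setT (fun x => (F x r)%:E).
Proof. by apply/measurable_EFinP; exact: measurable_conditional_cdf. Qed.

Let F0 x r : 0 <= (F x r)%:E.
Proof. by rewrite lee_fin conditional_cdf_ge0. Qed.

(** Monotonicity is used only between [r] and the countably many rationals above it, so one null set
    suffices; off it, every term of the infimum dominates [g r x]. *)
Let le_g_F r : {ae mu, forall x, (g r x <= F x r)%R}.
Proof.
have h : {ae mu, forall x, forall n, (r < rat_enum R n)%R ->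
    (g r x <= g (rat_enum R n) x)%R}.
  apply: ae_foralln => n; case: (boolP (r < rat_enum R n)%R) => [rn|_].
    by move: (g_nondecreasing (ltW rn)); apply: filterS => x ? _.
  exact: aeW.
move: h (g_le1 r); apply: filterS2 => x h g1.
apply: le_conditional_cdf => n; rewrite /cdf_term; case: ifP => // rn.
by rewrite le_min g1 h.
Qed.

(** One inequality integrates [le_g_F]. For the other, [F x r <= g q x] at every [x] for rational
    [q > r]; the right side integrates to the mass of [A] times the ray up to [q], and continuity
    from above applies as [q] decreases to [r]. *)
Let integral_F r A : measurable A ->
  \int[mu]_(x in A) (F x r)%:E = zeta (A `*` `]-oo, r]%classic).
Proof.
move=> mA; apply/eqP; rewrite eq_le; apply/andP; split; last first.
  rewrite gE//; apply: ae_ge0_le_integral => //.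
  - by move=> x _; rewrite lee_fin.
  - by apply/measurable_funTS/measurable_EFinP.
  - exact: measurable_funTS.
  - by move: (le_g_F r); apply: filterS => x ? _; rewrite lee_fin.
rewrite -(snd_sliceE _ mA) (itvNycEbigcap false).
pose I n : set (measurableTypeR R) := `]-oo, (r + n.+1%:R^-1)%R]%classic.
have : snd_slice zeta mA (I n) @[n --> \oo] -->
       snd_slice zeta mA (\bigcap_n I n).
  apply: nonincreasing_cvg_mu => [|n||m n mn].
  - by rewrite snd_sliceE zeta_fin//; apply: measurableX => //; exact: mray.
  - exact: mray.
  - by apply: bigcap_measurable => // n _; exact: mray.
  - apply/subsetPset/subset_itvl.
    by rewrite bnd_simp lerD2l lef_pV2 ?posrE// ler_nat.
move/cvge_to_ge; apply; apply: nearW => n.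
have [m /andP[rm mn]] : exists m, (r < rat_enum R m < r + n.+1%:R^-1)%R.
  by apply: rat_enum_itv; rewrite ltrDl invr_gt0.
apply: (@le_trans _ _ (\int[mu]_(x in A) (g (rat_enum R m) x)%:E)).
  apply: ge0_le_integral => //.
  - exact: measurable_funTS.
  - by apply/measurable_funTS/measurable_EFinP.
  - move=> x _; rewrite lee_fin (le_trans (conditional_cdf_le_term _ _ _ m))//.
    by rewrite /cdf_term rm ge_min lexx.
rewrite -gE// snd_sliceE le_measure ?inE//.
- exact: measurableX.
- by apply: measurableX => //; exact: mray.
- apply: setSX => // y; rewrite /I/= !in_itv/= => /le_trans; apply.
  exact: ltW.
Qed.

Let integrable_F r A : measurable A ->
  mu.-integrable A (fun x => (F x r)%:E).
Proof.
move=> mA; apply/integrableP; split; first exact: measurable_funTS.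
under eq_integral do rewrite gee0_abs//.
by rewrite integral_F// zeta_fin//; exact: measurableX.
Qed.

Theorem disintegration_real : exists k : R.-spker X ~> measurableTypeR R,
  forall C, measurable C -> zeta C = semidirect mu k C.
Proof.
have [k kE] := exists_stieltjes_kernel g0 mg.
(* Uniqueness of measures is used twice: here in [B] with [A] fixed, from half-open intervals, and
   at the end from rectangles. *)
have rect A B : measurable A -> measurable B ->
    zeta (A `*` B) = semidirect mu k (A `*` B).
  move=> mA mB; rewrite -!(snd_sliceE _ mA).
  have := @measure_unique _ R (measurableTypeR R) (@ocitv R)
    (fun n => `](- n%:R)%R, (n%:R)%R]%classic) _ _ _ _
    (snd_slice zeta mA) (snd_slice (semidirect mu k) mA) _ _ B mB.
  apply => //.
  - exact: ocitvI.
  - by move=> n; exact: is_ocitv.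
  - exact: (bigcup_itvT false false).
  - move=> _ [[a b] _ <-]/=; rewrite !snd_sliceE semidirect_setX//.
    (* [ocitv] also contains the intervals with reversed endpoints, which are empty. *)
    have [ab|ba] := leP a b; last first.
      rewrite set_itv_ge; last by rewrite bnd_simp -leNgt ltW.
      rewrite setX0 measure0.
      by under eq_integral do rewrite measure0; rewrite integral0.
    under eq_integral do rewrite kE//.
    rewrite integralB_EFin//; [|exact: integrable_F..].
    rewrite !integral_F// -!(snd_sliceE _ mA).
    rewrite (_ : `]a, b] = `]-oo, b] `\` `]-oo, a])%classic; last first.
      apply/seteqP; split=> y/=; rewrite !in_itv/=.
        by move=> /andP[ay ->]; split=> //; apply/negP; rewrite -ltNge.
      by move=> [-> /negP]; rewrite -ltNge => ->.
    rewrite measureD; [|exact: mray..|].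
      congr (_ - snd_slice zeta mA _); apply/setIidr/subset_itvl.
      by rewrite bnd_simp.
    by rewrite [ltLHS](snd_sliceE zeta mA) zeta_fin//; exact: measurableX.
  - move=> n; by rewrite snd_sliceE zeta_fin//; exact: measurableX.
exists k; apply: product_measure_unique => //.
by rewrite zeta_fin.
Qed.

End disintegration_real.

(** * Coding bit sequences by real numbers *)

Section base4_encoding.
Variable R : realType.
Implicit Type b : nat -> bool.

(* Bits are used as base-4 digits: the tail after any digit is then at most 1/3
   of a unit, so every digit can be read off by truncation. *)
Fixpoint base4_prefix b n : nat :=
  if n is m.+1 then (4 * base4_prefix b m + b m)%N else 0%N.

Definition base4_partial b n : R := ((base4_prefix b n)%:R / 4 ^+ n)%R.

Definition base4_real b : R := sup (range (base4_partial b)).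

(** The constant 1/3 is the sum of [4^-i] over [i >= 1], the tail when all later bits are 1. Since
    [1/3 = (1 + 1/3) / 4], these upper bounds do not increase. *)
Let base4_upper b n : R := (((base4_prefix b n)%:R + 3^-1) / 4 ^+ n)%R.

Let exp4_gt0 n : (0 < 4 ^+ n :> R)%R.
Proof. by rewrite exprn_gt0. Qed.

Lemma base4_partial_nondecreasing b : nondecreasing_seq (base4_partial b).
Proof.
apply/nondecreasing_seqP => n; rewrite /base4_partial/= exprS invfM mulrA.
rewrite ler_pM2r ?invr_gt0// ler_pdivlMr//.
by rewrite natrD natrM mulrC lerDl.
Qed.

Let base4_upper_nonincreasing b : nonincreasing_seq (base4_upper b).
Proof.
apply/nonincreasing_seqP => n; rewrite /base4_upper/= exprS invfM mulrA.
rewrite ler_pM2r ?invr_gt0// ler_pdivrMr// natrD natrM.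
have : ((b n)%:R <= 1 :> R)%R by case: (b n).
by lra.
Qed.

Let base4_partial_le_upper b n m : (base4_partial b n <= base4_upper b m)%R.
Proof.
apply: (@le_trans _ _ (base4_partial b (maxn n m))).
  by apply: base4_partial_nondecreasing; exact: leq_maxl.
apply: (@le_trans _ _ (base4_upper b (maxn n m))).
  by rewrite ler_pM2r ?invr_gt0// lerDl invr_ge0.
by apply: base4_upper_nonincreasing; exact: leq_maxr.
Qed.

Let has_ubound_base4_partial b : has_ubound (range (base4_partial b)).
Proof. by exists (base4_upper b 0) => _ [n _ <-]. Qed.

Lemma base4_partial_cvg b : base4_partial b n @[n --> \oo] --> base4_real b.
Proof.
exact: nondecreasing_cvgn (@base4_partial_nondecreasing b) _.
Qed.

(** The code lies between the lower and upper approximations, and 1/3 < 1 makes the right inequality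
    strict: the prefix is an integer part. *)
Lemma base4_real_itv b n :
  ((base4_prefix b n)%:R <= 4 ^+ n * base4_real b < (base4_prefix b n).+1%:R)%R.
Proof.
rewrite mulrC -ler_pdivrMr// ub_le_sup//=; last by exists n.
rewrite -ltr_pdivlMr// (@le_lt_trans _ _ (base4_upper b n))//.
  by apply: ge_sup => [|_ [m _ <-]//]; exists (base4_partial b 0), 0%N.
by rewrite ltr_pM2r ?invr_gt0// -[ltRHS]natr1; lra.
Qed.

(** Here [j] is the integer part of [4 ^+ n.+1 * r]. For a code it is the prefix of length [n.+1],
    whose parity is bit [n], the earlier digits being multiplied by 4. *)
Definition base4_digit n : set (measurableTypeR R) :=
  [set r | exists2 j, odd j & (j%:R <= 4 ^+ n.+1 * r < j.+1%:R)%R].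

Lemma base4_digit_real b n : base4_digit n (base4_real b) <-> b n.
Proof.
have /andP[h1 h2] := base4_real_itv b n.+1.
have oddE : odd (base4_prefix b n.+1) = b n.
  by rewrite /= oddD oddM/= oddb.
split=> [[j oj /andP[jr rj]]|bn].
  rewrite -oddE (_ : base4_prefix b n.+1 = j)//; apply/eqP.
  have /(le_lt_trans h1) := rj; have /(le_lt_trans jr) := h2.
  by rewrite !ltr_nat !ltnS eqn_leq => -> ->.
by exists (base4_prefix b n.+1); rewrite ?oddE// h1.
Qed.

Lemma measurable_base4_digit n : measurable (base4_digit n).
Proof.
rewrite (_ : base4_digit n = \bigcup_(j in [set j | odd j])
    `[(j%:R / 4 ^+ n.+1)%R, (j.+1%:R / 4 ^+ n.+1)%R[%classic).
  by apply: bigcup_measurable => j _; exact: measurable_itv.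
apply/seteqP; split=> r [j oj jr]; exists j => //; move: jr;
  by rewrite /= in_itv/= ler_pdivrMr// ltr_pdivlMr// [(r * _)%R]mulrC.
Qed.

Lemma measurable_base4_real d (T : measurableType d) (b : T -> nat -> bool) :
  (forall n, measurable [set x | b x n]) ->
  measurable_fun setT (fun x => base4_real (b x)).
Proof.
move=> mb; apply: (@measurable_fun_cvg _ _ _ _ (fun n x => base4_partial (b x) n)).
  move=> n; apply: measurable_funM => //.
  elim: n => [|n ih]/=; first exact: measurable_cst.
  under eq_fun do rewrite natrD natrM.
  apply: measurable_funD; first exact: measurable_funM.
  rewrite (_ : (fun _ => _) = \1_[set x | b x n]); first exact: measurable_indic.
  by apply/funext => x; rewrite indicE mem_setE.
by move=> x _; exact: base4_partial_cvg.
Qed.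

End base4_encoding.

(** * Measurable choice of a least index *)

Section least_index.
Context d (T : measurableType d) (P : nat -> set T).

Let least k := [set x | P k x /\ forall j, (j < k)%N -> ~ P j x].

Definition least_index (x : T) : nat := xget 0%N [set k | least k x].

Lemma least_indexP x : (exists k, P k x) -> P (least_index x) x.
Proof.
move=> [k Pk]; suff [] : least (least_index x) x by [].
apply: (@xgetPex _ _ [set k | least k x]).
elim/ltn_ind: k Pk => k ih Pk.
have [[j jk Pj]|noj] := pselect (exists2 j, (j < k)%N & P j x); first exact: (ih j).
by exists k; split=> // j jk Pj; apply: noj; exists j.
Qed.

Lemma measurable_least_index : (forall k, measurable (P k)) ->
  measurable_fun setT least_index.
Proof.
move=> mP _ A _; rewrite setTI.
have mleast k : measurable (least k).
  rewrite (_ : least k = P k `&` \bigcap_(j in `I_k) ~` P j).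
    apply: measurableI => //; apply: bigcap_measurableType => j _.
    exact: measurableC.
  by apply/seteqP; split => x [].
have leastE k x : least k x -> least_index x = k.
  move=> kx; apply: xget_unique => // j [Pj jx]; case: kx => Pk kx.
  by case: (ltngtP j k) => [/kx|/jx|].
have noneE x : (~` \bigcup_k least k) x -> least_index x = 0%N.
  by move=> nx; apply: xgetPN => k kx; apply: nx; exists k.
(* Points that lie in no [P k] get the default index 0, so they belong to the preimage exactly when
   [A] contains 0. *)
have -> : least_index @^-1` A = (\bigcup_(k in A) least k) `|`
    (if pselect (A 0%N) then ~` \bigcup_k least k else set0).
  apply/seteqP; split=> x.
    move=> Ax; have [[k _ kx]|nx] := pselect ((\bigcup_k least k) x).
      by left; exists k => //; rewrite -(leastE _ _ kx).
    by right; move: Ax; rewrite /preimage/= noneE//; case: pselect.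
  case=> [[k Ak kx]|]; first by rewrite /preimage/= (leastE _ _ kx).
  by case: pselect => // A0 nx; rewrite /preimage/= noneE.
apply: measurableU; first exact: bigcup_measurable.
case: pselect => [A0|A0]/=; last exact: measurable0.
by apply: measurableC; exact: bigcup_measurable.
Qed.

End least_index.

(** * Dense sequences and countable bases *)

Lemma dense_sequence (T : ptopologicalType) : separable_space T ->
  exists s : nat -> T, dense (range s).
Proof.
move=> [D /countable_injP[f finj] dD].
(* The injection [f] is inverted; indices outside its image on [D] give [point], and enlarging [D]
   keeps it dense. *)
exists (fun n => xget point [set x | D x /\ f x = n]) => O O0 oO.
have [x [Ox Dx]] := dD O O0 oO; exists x; split=> //; exists (f x) => //.
apply: xget_unique => // y [Dy fyx]; apply: finj => //; exact/mem_set.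
Qed.

Lemma near_harmonic_lt (R : realType) (e : R) : (0 < e)%R ->
  \forall n \near \oo, (n.+1%:R^-1 < e)%R.
Proof.
move=> e0; have := @cvg_harmonic R; move/cvgrPdist_lt => /(_ e e0).
by apply: filterS => n; rewrite sub0r normrN gtr0_norm ?invr_gt0.
Qed.

Section dense_ball.
Variables (R : realType) (Y : pseudoPMetricType R) (s : nat -> Y).
Hypothesis s_dense : dense (range s).

(** A [ball] of a pseudometric structure is not assumed open, hence the interior. *)
Definition dense_ball (nk : nat * nat) : set Y :=
  (ball (s nk.2) (nk.1.+1%:R^-1 : R))°.

Lemma open_dense_ball nk : open (dense_ball nk).
Proof. exact: open_interior. Qed.

Lemma dense_ball_cover n y : exists k, dense_ball (n, k) y.
Proof.
have e0 : (0 < n.+1%:R^-1 / 2 :> R)%R by rewrite divr_gt0 ?invr_gt0.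
have [x [/interior_subset yx [k _ skx]]] := s_dense
  (ex_intro _ y (nbhsx_ballx y _ e0)) (@open_interior _ _).
exists k; apply: filterS (nbhsx_ballx y _ e0) => z yz.
rewrite /= skx [X in ball _ X]splitr; apply: ball_triangle yz.
exact: ball_sym.
Qed.

Lemma dense_ball_basis y (U : set Y) : nbhs y U ->
  exists nk, dense_ball nk y /\ dense_ball nk `<=` U.
Proof.
move=> /nbhs_ballP[e /= e0 eU].
have [n _ /(_ n (leqnn n)) /= ne] := near_harmonic_lt (divr_gt0 e0 (ltr0n _ 2)).
have [k yk] := dense_ball_cover n y; exists (n, k); split=> // z zk; apply: eU.
rewrite [X in ball _ X](splitr e).
apply: (@ball_triangle _ _ (s k)).
  apply: ball_sym; apply: le_ball (interior_subset yk); exact: ltW.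
by apply: le_ball (interior_subset zk); exact: ltW.
Qed.

End dense_ball.

(** * A separable complete metric space as a measurable retract of the line *)

Section polish_retract.
Variables (R : realType) (Y : completeMetricType R).
Variable s : nat -> Y.
Hypothesis s_dense : dense (range s).

Let radius n : R := n.+1%:R^-1.

Let radius_gt0 n : (0 < radius n)%R.
Proof. by rewrite invr_gt0. Qed.

(** Every pair occurs, at its own [pickle]; the other indices repeat [(0, 0)]. *)
Let code (i : nat) : nat * nat := odflt (0%N, 0%N) (unpickle i).

Definition polish_code (y : borel Y) : measurableTypeR R :=
  base4_real R (fun i => `[< dense_ball s (code i) y >]).

Let measurable_polish_code : measurable_fun setT polish_code.
Proof.
apply: measurable_base4_real => i.
rewrite (_ : [set _ | _] = dense_ball s (code i)).
  by apply: sub_sigma_algebra; exact: open_dense_ball.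
by apply/seteqP; split=> y /= /asboolP.
Qed.

(** The first [k] such that, according to the digits of the real number, the coded point lies in
    [dense_ball s (n, k)]. *)
Let index (n : nat) : measurableTypeR R -> nat :=
  least_index (fun k => @base4_digit R (pickle (n, k))).

Let measurable_index n (A : set nat) : measurable (index n @^-1` A).
Proof.
rewrite -[X in measurable X]setTI.
by apply: measurable_least_index => // k; exact: measurable_base4_digit.
Qed.

Let index_code n y : ball (s (index n (polish_code y))) (radius n) y.
Proof.
have digitE k : @base4_digit R (pickle (n, k)) (polish_code y) <->
    dense_ball s (n, k) y.
  rewrite base4_digit_real /code pickleK.
  by split; [move/asboolP|move=> ?; exact/asboolP].
suff /digitE : @base4_digit R (pickle (n, index n (polish_code y)))
    (polish_code y).
  exact: interior_subset.
apply: (least_indexP (P := fun k => @base4_digit R (pickle (n, k)))).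
by have [k /digitE] := dense_ball_cover s_dense n y; exists k.
Qed.

Let approx (r : measurableTypeR R) n : Y := s (index n r).

(* A measurable set of codes, containing all codes of points, on which the
   approximations converge. *)
Let fast_cauchy : set (measurableTypeR R) :=
  [set r | forall n m, (n <= m)%N ->
    ball (approx r n) (radius n *+ 2) (approx r m)].

Let measurable_fast_cauchy : measurable fast_cauchy.
Proof.
rewrite (_ : fast_cauchy = \bigcap_n \bigcap_(m in [set m | (n <= m)%N])
    \bigcup_i (index n @^-1` [set i] `&`
      index m @^-1` [set j | ball (s i) (radius n *+ 2) (s j)])).
  apply: bigcap_measurableType => n _; apply: bigcap_measurableType => m _.
  by apply: bigcup_measurable => i _; apply: measurableI; exact: measurable_index.
apply/seteqP; split=> [r rF n _ m nm|r rF n m nm].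
  by exists (index n r) => //; split=> //; exact: rF.
by have [i _ [<-]] := rF n I m nm.
Qed.

Definition polish_decode (r : measurableTypeR R) : borel Y :=
  if r \in fast_cauchy then lim (approx r @ \oo) else point.

Let cvg_approx r : fast_cauchy r -> cvg (approx r @ \oo).
Proof.
move=> rF; apply: cauchy_cvg; apply: cauchy_exP => e e0.
(* [fast_cauchy] allows twice the radius, hence [e / 2]. *)
have [n _ ne] := near_harmonic_lt (divr_gt0 e0 (ltr0n _ 2)).
exists (approx r n); exists n => // m /= nm.
apply: le_ball (rF n m nm).
by rewrite -mulr_natr -ler_pdivlMr// ltW// ne/=.
Qed.

Let approx_decode r : fast_cauchy r -> approx r @ \oo --> (polish_decode r : Y).
Proof. by move=> rF; rewrite /polish_decode mem_set//; exact: cvg_approx. Qed.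

Let measurable_polish_decode : measurable_fun setT polish_decode.
Proof.
apply: (@measurability _ _ (measurableTypeR R) (borel Y) setT polish_decode
  (@open Y) erefl) => _ [U oU <-]; rewrite setTI.
(* A limit lies in the open set [U] iff, for some [k], the approximations eventually stay in [V k].
   The set [W] expressing this is measurable because [index n] takes values in [nat] and every set
   of indices has a measurable preimage. *)
pose V k := [set y : Y | ball y (radius k) `<=` U].
pose W := \bigcup_k \bigcup_N \bigcap_(n in [set n | (N <= n)%N])
  index n @^-1` (s @^-1` V k).
have decodeE r : fast_cauchy r -> U (polish_decode r) <-> W r.
  move=> rF; have rcvg := approx_decode rF; split=> [Ur|[k _ [N _ NV]]].
    have /nbhs_ballP[e /= e0 eU] := open_nbhs_nbhs (conj oU Ur).
    have e20 : (0 < e / 2)%R by rewrite divr_gt0.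
    have [k _ /(_ k (leqnn k)) /= ke] := near_harmonic_lt e20.
    have /cvg_ballP/(_ _ e20)[N _ Ne] := rcvg.
    exists k => //; exists N => // n /= Nn z kz; apply: eU.
    rewrite [X in ball _ X](splitr e); apply: ball_triangle (Ne n Nn) _.
    exact: le_ball (ltW ke) _ kz.
  have /cvg_ballP/(_ _ (radius_gt0 k))[M _ Mk] := rcvg.
  apply: (NV (maxn N M)); first exact: leq_maxl.
  by apply: ball_sym; apply: Mk; exact: leq_maxr.
have mW : measurable W.
  apply: bigcup_measurable => k _; apply: bigcup_measurable => N _.
  by apply: bigcap_measurableType => n _; exact: measurable_index.
rewrite (_ : _ @^-1` U =
    (fast_cauchy `&` W) `|` (~` fast_cauchy `&` (fun=> U point))).
  apply: measurableU; apply: measurableI => //; first exact: measurableC.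
  have [Up|nUp] := pselect (U point).
    by rewrite (_ : (fun=> _) = setT)//; apply/seteqP; split.
  by rewrite (_ : (fun=> _) = set0)//; apply/seteqP; split.
apply/seteqP; split=> r.
  move=> Ur; have [rF|nrF] := pselect (fast_cauchy r).
    by left; split=> //; exact/decodeE.
  by right; split=> //; move: Ur; rewrite /preimage/= /polish_decode memNset.
case=> -[rF Wr]; first exact/(decodeE _ rF).
by rewrite /preimage/= /polish_decode memNset.
Qed.

Let polish_codeK : cancel polish_code polish_decode.
Proof.
move=> y; set r := polish_code y.
have rF : fast_cauchy r.
  (* Both centres lie within their own radius of [y]; this is the source of the factor 2 in
     [fast_cauchy]. *)
  move=> n m nm; apply: (@le_ball _ _ _ (radius n + radius m)%R).
    by rewrite mulr2n lerD2l lef_pV2 ?posrE// ler_nat.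
  by apply: ball_triangle (index_code n y) _; apply: ball_sym; exact: index_code.
apply: (@cvg_unique _ (@metric_hausdorff _ Y) (approx r @ \oo)) => //.
  exact: approx_decode.
apply/cvg_ballP => e e0; apply: filterS (near_harmonic_lt e0) => n ne.
by apply: ball_sym; apply: le_ball (index_code n y); exact: ltW.
Qed.

Lemma exists_polish_code :
  exists (phi : borel Y -> measurableTypeR R)
         (psi : measurableTypeR R -> borel Y),
    [/\ measurable_fun setT phi, measurable_fun setT psi & cancel phi psi].
Proof. by exists polish_code, polish_decode; split. Qed.

End polish_retract.

(** * Transfer to a Polish second factor *)

Section kernel_image.
Context d d1 d2 (X : measurableType d) (Y : measurableType d1)
  (Z : measurableType d2) (R : realType).
Variables (k : R.-spker X ~> Y) (f : Y -> Z).

Definition kernel_image (mf : measurable_fun setT f) (x : X) :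
    {measure set Z -> \bar R} :=
  image_measure (k x) mf.

Hypothesis mf : measurable_fun setT f.

Let measurable_kernel_image U : measurable U ->
  measurable_fun setT (kernel_image mf ^~ U).
Proof.
move=> mU; apply: (measurable_kernel k (f @^-1` U)).
by rewrite -[X in measurable X]setTI; exact: mf.
Qed.

HB.instance Definition _ := isKernel.Build _ _ _ _ R (kernel_image mf)
  measurable_kernel_image.

Let kernel_image_sprob :
  ereal_sup [set kernel_image mf x setT | x in [set: X]] <= 1.
Proof.
by apply: ge_ereal_sup => _ [x _ <-]; exact: (sprob_kernel_le1 k).
Qed.

HB.instance Definition _ := Kernel_isSubProbability.Build _ _ _ _ R
  (kernel_image mf) kernel_image_sprob.

End kernel_image.

Lemma disintegration_polish_snd d (X : measurableType d) (R : realType)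
    (Y : completeMetricType R) (zeta : {measure set (X * borel Y) -> \bar R})
    (mu : probability X R) :
  separable_space Y ->
  (forall A, measurable A -> mu A = zeta (A `*` setT)) ->
  exists k : R.-spker X ~> borel Y,
    forall C, measurable C -> zeta C = semidirect mu k C.
Proof.
move=> /dense_sequence[s /exists_polish_code[phi [psi [mphi mpsi phiK]]]] mu_fst.
pose code (z : X * borel Y) : X * measurableTypeR R := (z.1, phi z.2).
have mcode : measurable_fun setT code.
  by apply: measurable_fun_pair => //; exact: measurableT_comp.
pose decode (z : X * measurableTypeR R) : X * borel Y := (z.1, psi z.2).
have mdecode : measurable_fun setT decode.
  by apply: measurable_fun_pair => //; exact: measurableT_comp.
have [|k kE] := @disintegration_real _ _ _ (image_measure zeta mcode) mu.
  by move=> A mA; rewrite mu_fst.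
exists (kernel_image k mpsi) => C mC.
(* [decode] after [code] is the identity, by [phiK]. *)
transitivity (image_measure zeta mcode (decode @^-1` C)).
  congr (zeta _); apply/seteqP; split=> -[x y];
    by rewrite /decode/code/preimage/= phiK.
rewrite kE; last by rewrite -[X in measurable X]setTI; exact: mdecode.
rewrite !semidirectE; apply: eq_integral => x _.
by rewrite /= /kernel_image /image_measure/= /pushforward !xsectionE.
Qed.

(** * Borel sets of a product *)

Lemma open_prod_measurable (X : ptopologicalType) (R : realType)
    (Y : pseudoPMetricType R) (U : set (X * Y)) :
  separable_space Y -> open U ->
  @measurable _ (borel X * borel Y)%type U.
Proof.
move=> /dense_sequence[s sd] oU.
(* Each ball of the countable base of [Y] is paired with the largest open set of [X] whose product
   with it lies in [U]. *)
pose V nk := [set x | forall y, dense_ball s nk y -> U (x, y)]°.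
rewrite (_ : U = \bigcup_nk (V nk `*` dense_ball s nk)).
  apply: countable_bigcupT_measurable => [//|nk]; apply: measurableX.
    by apply: sub_sigma_algebra; exact: open_interior.
  by apply: sub_sigma_algebra; exact: open_dense_ball.
apply/seteqP; split=> -[x y].
  move=> Uxy; have [[A B]/= [nA nB] AB] := open_nbhs_nbhs (conj oU Uxy).
  have [nk [ynk nkB]] := dense_ball_basis sd nB.
  exists nk => //; split=> //=.
  apply: filterS nA => x' Ax' y' /nkB By'.
  exact: (AB (x', y')).
by case=> i _ [/= /interior_subset xV]; exact: xV.
Qed.

Lemma measurable_borel_prodE (X : ptopologicalType) (R : realType)
    (Y : pseudoPMetricType R) : separable_space Y ->
  @measurable _ (borel (X * Y)) = @measurable _ (borel X * borel Y)%type.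
Proof.
move=> sepY; apply/seteqP; split.
  apply: smallest_sub; first exact: sigma_algebra_measurable.
  by move=> U; exact: open_prod_measurable.
rewrite measurable_prod_measurableType.
apply: smallest_sub; first exact: sigma_algebra_measurable.
move=> _ [A mA [B mB <-]].
have mfst : @measurable_fun _ _ (borel (X * Y)) (borel X) setT fst.
  apply: (@measurability _ _ (borel (X * Y)) (borel X) setT fst (@open X) erefl).
  move=> _ [U oU <-]; apply: sub_sigma_algebra; rewrite setTI.
  by apply: open_comp => // z _; exact: cvg_fst.
have msnd : @measurable_fun _ _ (borel (X * Y)) (borel Y) setT snd.
  apply: (@measurability _ _ (borel (X * Y)) (borel Y) setT snd (@open Y) erefl).
  move=> _ [U oU <-]; apply: sub_sigma_algebra; rewrite setTI.
  by apply: open_comp => // z _; exact: cvg_snd.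
have -> : A `*` B = (setT `&` fst @^-1` A) `&` (setT `&` snd @^-1` B).
  by rewrite !setTI.
by apply: measurableI; [exact: mfst|exact: msnd].
Qed.

(** * Consequences of the integral formula for nonnegative functions *)

Section disintegrates.
Context d d1 d2 (T : measurableType d) (X : measurableType d1)
  (Y : measurableType d2) (R : realType).
Variables (zeta : {measure set T -> \bar R}) (mu : {measure set X -> \bar R}).
Variables (k : X -> {measure set Y -> \bar R}) (e : X -> Y -> T).

(** The map [e x] embeds the fibre over [x]. Leaving it abstract lets the same lemmas serve both
    orders of the coordinates. *)
Definition disintegrates := (forall x, measurable_fun setT (e x)) /\
  forall f : T -> \bar R, measurable_fun setT f -> (forall z, 0 <= f z) ->
    measurable_fun setT (fun x => \int[k x]_y f (e x y)) /\
    \int[zeta]_z f z = \int[mu]_x \int[k x]_y f (e x y).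

Hypothesis dis : disintegrates.

Let measurable_fiber x : measurable_fun setT (e x).
Proof. exact: dis.1. Qed.

Let measurable_comp_fiber (f : T -> R) x : measurable_fun setT f ->
  measurable_fun setT (fun y => f (e x y)).
Proof. by move=> mf; exact: measurableT_comp. Qed.

Lemma disintegrates_set C : measurable C ->
  measurable_fun setT (fun x => k x (e x @^-1` C)) /\
  zeta C = \int[mu]_x k x (e x @^-1` C).
Proof.
move=> mC; have [|z|] := dis.2 (EFin \o \1_C).
- by apply/measurable_EFinP.
- by rewrite lee_fin.
have -> : (fun x => \int[k x]_y (EFin \o \1_C) (e x y)) =
    (fun x => k x (e x @^-1` C)).
  apply/funext => x; rewrite -[X in k x X]setIT -integral_indic//.
  by rewrite -[X in measurable X]setTI; exact: measurable_fiber.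
by move=> mk <-; split=> //; rewrite integral_indic// setIT.
Qed.

(** Both sides say that the integral of [|f|] is finite, by the formula for nonnegative functions
    applied to [|f|]. *)
Lemma disintegrates_integrableP (f : T -> R) : measurable_fun setT f ->
  zeta.-integrable setT (EFin \o f) <->
  mu.-integrable setT (fun x => \int[k x]_y `|f (e x y)|%:E).
Proof.
move=> mf; have [||mg fE] := dis.2 (fun z => `|f z|%:E).
- by apply/measurable_EFinP; exact: measurableT_comp.
- by move=> z; rewrite lee_fin.
have absE : \int[mu]_x `|\int[k x]_y `|f (e x y)|%:E| = \int[zeta]_z `|f z|%:E.
  rewrite fE; apply: eq_integral => x _; rewrite gee0_abs//.
  by apply: integral_ge0 => y _; rewrite lee_fin.
split=> /integrableP[_ foo]; apply/integrableP; split.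
- exact: mg.
- by rewrite absE.
- exact/measurable_EFinP.
- by move: foo; rewrite absE.
Qed.

Lemma disintegrates_integrable (f : T -> R) :
  zeta.-integrable setT (EFin \o f) ->
  [/\ {ae mu, forall x, (k x).-integrable setT (fun y => (f (e x y))%:E)},
    mu.-integrable setT (fun x => \int[k x]_y (f (e x y))%:E) &
    \int[zeta]_z (f z)%:E = \int[mu]_x \int[k x]_y (f (e x y))%:E].
Proof.
move=> intf; have mf : measurable_fun setT f.
  exact/measurable_EFinP/measurable_int/intf.
have pn_int (g : T -> \bar R) :
    zeta.-integrable setT g -> (forall z, 0 <= g z) ->
    mu.-integrable setT (fun x => \int[k x]_y g (e x y)).
  move=> /integrableP[mg goo] g0; have [mG gE] := dis.2 _ mg g0.
  apply/integrableP; split=> //; move: goo.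
  under eq_integral do rewrite gee0_abs//.
  under [X in _ -> X < _]eq_integral do rewrite gee0_abs ?integral_ge0//.
  by rewrite gE.
have intpos := integrable_funepos measurableT intf.
have intneg := integrable_funeneg measurableT intf.
have intP := pn_int _ intpos (funepos_ge0 _).
have intN := pn_int _ intneg (funeneg_ge0 _).
(* This holds at every [x], even where [f] is not integrable on the fibre, since the integral is by
   definition the difference of these two. *)
have fiberE : (fun x => \int[k x]_y (f (e x y))%:E) =
    (fun x => \int[k x]_y (EFin \o f)^\+ (e x y)) \-
    (fun x => \int[k x]_y (EFin \o f)^\- (e x y)).
  apply/funext => x; rewrite [LHS]integralE.
  by congr (_ - _); apply: eq_integral => y _; rewrite ?(funeposE, funenegE).
split.
- have := integrable_ae measurableT ((disintegrates_integrableP mf).1 intf).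
  apply: filterS => x /(_ I) fin; apply/integrableP; split.
    by apply/measurable_EFinP; exact: measurable_comp_fiber.
  by rewrite -ge0_fin_numE ?integral_ge0.
- by rewrite fiberE; exact: integrableB.
- rewrite fiberE integralB// [LHS]integralE.
  have [_ ->] := dis.2 _ (measurable_int _ intpos) (funepos_ge0 _).
  by have [_ ->] := dis.2 _ (measurable_int _ intneg) (funeneg_ge0 _).
Qed.

End disintegrates.

(** * Disintegrations in both directions, and the final assembly *)

Theorem exists_disintegration (R : realType) (X Y : completeMetricType R)
    (zeta : {measure set (borel (X * Y)) -> \bar R})
    (mu : probability (borel X) R) :
  separable_space Y ->
  (forall A : set (borel X), measurable A -> mu A = zeta (A `*` setT)) ->
  exists k : borel X -> {measure set (borel Y) -> \bar R},
    disintegrates zeta mu k pair.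
Proof.
move=> sepY mu_fst.
(* The identity map, used to move [zeta] from the Borel sets of the product to the product
   sigma-algebra, on which kernels act. *)
pose toprod (z : borel (X * Y)) : borel X * borel Y := z.
have mtoprod : measurable_fun setT toprod.
  by move=> _ C mC; rewrite setTI measurable_borel_prodE//; exact: mC.
have [k kE] := disintegration_polish_snd
  (zeta := image_measure zeta mtoprod) sepY mu_fst.
exists k; split=> [x _ C|f].
  rewrite measurable_borel_prodE// => mC; exact: pair1_measurable.
move=> mf f0.
have mf' : @measurable_fun _ _ (borel X * borel Y)%type _ setT f.
  move=> _ B mB; have := mf measurableT B mB.
  by rewrite measurable_borel_prodE.
split.
  exact: (@measurable_kfcomp _ _ _ _ _ k f mf' f0).
rewrite -[RHS]ge0_integral_semidirect//.
have -> : \int[zeta]_z f z = \int[image_measure zeta mtoprod]_z f z.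
  by rewrite [RHS](ge0_integral_pushforward mtoprod).
by apply: eq_measure_integral => C mC _; rewrite kE.
Qed.

Lemma measurable_swap_borel (S T : ptopologicalType) :
  @measurable_fun _ _ (borel (S * T)) (borel (T * S)) setT
    (fun z => (z.2, z.1)).
Proof.
apply: (@measurability _ _ (borel (S * T)) (borel (T * S)) setT
  (fun z => (z.2, z.1)) open erefl).
move=> _ [U oU <-]; apply: sub_sigma_algebra; rewrite setTI.
by apply: open_comp => // z _; exact: swap_continuous.
Qed.

(** The previous result, applied to the image of [zeta] under the exchange of coordinates. *)
Lemma exists_disintegration_swap (R : realType) (X Y : completeMetricType R)
    (zeta : {measure set (borel (X * Y)) -> \bar R})
    (nu : probability (borel Y) R) :
  separable_space X ->
  (forall B : set (borel Y), measurable B -> nu B = zeta ([set: X] `*` B)) ->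
  exists k : borel Y -> {measure set (borel X) -> \bar R},
    disintegrates zeta nu k (fun y x => (x, y)).
Proof.
move=> sepX nu_snd.
have mswap := @measurable_swap_borel X Y.
have [|k [mk kE]] := exists_disintegration
  (zeta := image_measure zeta mswap) (mu := nu) sepX.
  move=> B mB; rewrite nu_snd//; congr (zeta _).
  by apply/seteqP; split=> -[x y] [].
exists k; split=> [y|f mf f0].
  exact: (measurableT_comp (@measurable_swap_borel Y X) (mk y)).
have mfs := measurableT_comp mf (@measurable_swap_borel Y X).
have [mg gE] := kE _ mfs (fun z => f0 _).
split; first exact: mg.
rewrite -gE [RHS](ge0_integral_pushforward mswap)//; last by move=> z _; exact: f0.
by apply: eq_integral => -[x y].
Qed.

Theorem theorem2p1 (R : realType) (X Y : completeMetricType R)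
  (sepX : separable_space X) (lcX : locally_compact [set: X])
  (sepY : separable_space Y) (lcY : locally_compact [set: Y])
  (zeta : probability (borel (X * Y)) R)
  (mu : probability (borel X) R) (nu : probability (borel Y) R)
  (mu_marginal : forall A : set (borel X), measurable A ->
     mu A = zeta (A `*` [set: Y]))
  (nu_marginal : forall B : set (borel Y), measurable B ->
     nu B = zeta ([set: X] `*` B)) :
  exists (E1 : set (borel X))
         (nu_ : borel X -> {measure set (borel Y) -> \bar R})
         (E2 : set (borel Y))
         (mu_ : borel Y -> {measure set (borel X) -> \bar R}),
    (measurable E1 /\ mu E1 = 0) /\ (measurable E2 /\ nu E2 = 0) /\
    (* (A) *)
    [/\ forall C : set (borel (X * Y)), measurable C ->
          measurable_fun (~` E1) (fun x => nu_ x (xsection C x)) /\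
          zeta C = \int[mu]_(x in ~` E1) nu_ x (xsection C x),
        forall B : set (borel Y), measurable B ->
          nu B = \int[mu]_(x in ~` E1) nu_ x B
      & forall f : borel (X * Y) -> R,
          (forall z, (0 <= f z)%R) -> measurable_fun [set: borel (X * Y)] f ->
          measurable_fun (~` E1) (fun x => \int[nu_ x]_y (f (x, y))%:E) /\
          \int[zeta]_z (f z)%:E =
          \int[mu]_(x in ~` E1) \int[nu_ x]_y (f (x, y))%:E] /\
    (* (B) *)
    [/\ forall C : set (borel (X * Y)), measurable C ->
          measurable_fun (~` E2) (fun y => mu_ y (ysection C y)) /\
          zeta C = \int[nu]_(y in ~` E2) mu_ y (ysection C y),
        forall A : set (borel X), measurable A ->
          mu A = \int[nu]_(y in ~` E2) mu_ y A
      & forall f : borel (X * Y) -> R,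
          (forall z, (0 <= f z)%R) -> measurable_fun [set: borel (X * Y)] f ->
          measurable_fun (~` E2) (fun y => \int[mu_ y]_x (f (x, y))%:E) /\
          \int[zeta]_z (f z)%:E =
          \int[nu]_(y in ~` E2) \int[mu_ y]_x (f (x, y))%:E] /\
    (* (C) *)
    (forall f : borel (X * Y) -> R, measurable_fun [set: borel (X * Y)] f ->
       [<-> zeta.-integrable [set: borel (X * Y)] (EFin \o f);
            mu.-integrable (~` E1)
              (fun x => \int[nu_ x]_y (`|f (x, y)|%R)%:E);
            nu.-integrable (~` E2)
              (fun y => \int[mu_ y]_x (`|f (x, y)|%R)%:E)] /\
       (zeta.-integrable [set: borel (X * Y)] (EFin \o f) ->
          (* the iterated integrals are meaningful *)
          [/\ {ae mu, forall x, (~` E1) x ->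
                 (nu_ x).-integrable [set: borel Y] (fun y => (f (x, y))%:E)},
              mu.-integrable (~` E1) (fun x => \int[nu_ x]_y (f (x, y))%:E),
              {ae nu, forall y, (~` E2) y ->
                 (mu_ y).-integrable [set: borel X] (fun x => (f (x, y))%:E)}
            & nu.-integrable (~` E2) (fun y => \int[mu_ y]_x (f (x, y))%:E)] /\
          \int[zeta]_z (f z)%:E =
            \int[mu]_(x in ~` E1) \int[nu_ x]_y (f (x, y))%:E /\
          \int[mu]_(x in ~` E1) \int[nu_ x]_y (f (x, y))%:E =
            \int[nu]_(y in ~` E2) \int[mu_ y]_x (f (x, y))%:E)).
Proof.
have [nu_ nuP] := exists_disintegration sepY mu_marginal.
have [mu_ muP] := exists_disintegration_swap sepX nu_marginal.
exists set0, nu_, set0, mu_; rewrite !setC0.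
split; first by split.
split; first by split.
split.
  split=> [C mC|B mB|f f0 mf].
  - have [mk kE] := disintegrates_set nuP mC; under eq_fun do rewrite xsectionE.
    by split=> //; under eq_integral do rewrite xsectionE.
  - have mC : @measurable _ (borel (X * Y)) ([set: X] `*` B).
      by rewrite measurable_borel_prodE//; exact: measurableX.
    rewrite nu_marginal// (disintegrates_set nuP mC).2.
    by apply: eq_integral => x _; rewrite -xsectionE in_xsectionX// in_setT.
  - by apply: nuP.2 => [|z]; [exact/measurable_EFinP|rewrite lee_fin].
split.
  split=> [C mC|A mA|f f0 mf].
  - have [mk kE] := disintegrates_set muP mC; under eq_fun do rewrite ysectionE.
    by split=> //; under eq_integral do rewrite ysectionE.
  - have mC : @measurable _ (borel (X * Y)) (A `*` [set: Y]).
      by rewrite measurable_borel_prodE//; exact: measurableX.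
    rewrite mu_marginal// (disintegrates_set muP mC).2.
    by apply: eq_integral => y _; rewrite -ysectionE in_ysectionX// in_setT.
  - by apply: muP.2 => [|z]; [exact/measurable_EFinP|rewrite lee_fin].
move=> f mf; split.
  have h1 := disintegrates_integrableP nuP mf.
  have h2 := disintegrates_integrableP muP mf.
  (* The cycle is (1), (2), (3), (1); the passage from (2) to (3) goes through (1). *)
  by tfae; [exact: h1.1|move/h1.2/h2.1|exact: h2.2].
move=> intf.
have [ae1 int1 fE1] := disintegrates_integrable nuP intf.
have [ae2 int2 fE2] := disintegrates_integrable muP intf.
split; last by rewrite -fE1 -fE2.
by split=> //; [move: ae1|move: ae2]; apply: filterS.
Qed.
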